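(* Let $G$ be a countably infinite discrete abelian group and let $(g_k)_{k\geqslant 0}$ be a sequence of elements of $G$. Let $G_0$ be the subgroup of $G$ generated by $\{g_k : k\geqslant 0\}$. Assume that (1) the dual group $\widehat{G/G_0}$ is at most countable; (2) there exists $\varepsilon>0$ such that for every $\chi\in\widehat{G_0}\setminus\{\mathbf{1}\}$ we have $\sup_{k\geqslant 0}|\chi(g_k)-1|\geqslant\varepsilon$. Then $(g_k)_{k\geqslant 0}$ is a $G$-Jamison sequence.
   Context: For a complex Banach space $X$, $\mathcal{GL}(X)$ denotes the group of invertible bounded linear operators on $X$. A representation of a topological abelian group $G$ is a couple $(X,\rho)$ where $X$ is a separable infinite-dimensional complex Banach space and $\rho:G\to\mathcal{GL}(X)$ is a continuous group homomorphism (continuity is automatic when $G$ is discrete). $\mathbb{T}$ is the unit circle of the complex plane. For a topological abelian group $H$, $\widehat{H}$ is the group of all continuous homomorphisms (characters) $\chi:H\to\mathbb{T}$; for $H$ discrete, these are all homomorphisms $H\to\mathbb{T}$. $\mathbf{1}$ denotes the trivial character, identically equal to $1$. A character $\chi\in\widehat{G}$ is a unimodular eigenvalue of a representation $(X,\rho)$ of $G$ if there is $e_\chi\in X\setminus\{0\}$ such that $\rho(g)e_\chi=\chi(g)e_\chi$ for all $g\in G$. The set of unimodular eigenvalues is denoted by $\sigma_p(\rho)\cap\widehat{G}$. The representation is partially bounded with respect to a sequence $(g_k)_{k\geqslant 0}$ of elements of $G$ if $\sup_{k\geqslant 0}\|\rho(g_k)\|<+\infty$. A sequence $(g_k)_{k\geqslant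 0}$ of elements of $G$ is a $G$-Jamison sequence if for every representation $(X,\rho)$ of $G$ which is partially bounded with respect to $(g_k)_{k\geqslant 0}$, the set $\sigma_p(\rho)\cap\widehat{G}$ is at most countable. *)

(* Defs.v *)
From HB Require Import structures.
From mathcomp Require Import all_boot all_order all_algebra ring_quotient.
From mathcomp Require Import all_classical all_reals all_analysis.
From mathcomp Require Export complex.

Set Implicit Arguments.
Unset Strict Implicit.
Unset Printing Implicit Defensive.

Import Order.TTheory GRing.Theory Num.Theory.
Import numFieldNormedType.Exports.

Local Open Scope classical_set_scope.
Local Open Scope ring_scope.

(* Abelian groups are written additively and carry the discrete topology, so
   no continuity condition is imposed on characters and representations. *)

Section GeneratedSubgroup.
Variables (G : zmodType) (g : nat -> G).

Definition is_subgroup (A : set G) : Prop :=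
  A 0 /\ forall x y, A x -> A y -> A (x - y).

Definition gen_set : set G := smallest is_subgroup (range g).

Definition gen_pred : {pred G} := [pred x | x \in gen_set].

Lemma gen_pred_zmod_closed : zmod_closed gen_pred.
Proof.
split=> [|x y]; rewrite !inE; first by move=> A [[]].
by move=> gx gy A gA; apply: gA.1.2; [exact: gx|exact: gy].
Qed.

HB.instance Definition _ := GRing.isZmodClosed.Build G gen_pred
  gen_pred_zmod_closed.

Record gen_subgroup : Type := GenSubgroup {
  gen_val :> G;
  gen_valP : gen_val \in gen_pred
}.

HB.instance Definition _ := [isSub for gen_val].
HB.instance Definition _ := [Choice of gen_subgroup by <:].
HB.instance Definition _ := [SubChoice_isSubZmodule of gen_subgroup by <:].

Definition gen_quotient : zmodType := Quotient.quot gen_pred.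

Lemma gen_predP (k : nat) : g k \in gen_pred.
Proof. by rewrite inE => A [_]; apply; exists k. Qed.

Definition gen_elt (k : nat) : gen_subgroup := GenSubgroup (gen_predP k).

End GeneratedSubgroup.

Definition dual_group (R : realType) (H : zmodType) : set (H -> R[i]) :=
  [set chi | (forall x, `|chi x| = 1) /\
             {morph chi : x y / x + y >-> x * y}].
Arguments dual_group R H : clear implicits.

Section Operators.
Variables (R : realType) (X : completeNormedModType R[i]).

(* The norms of X and of R[i] take values in R[i]. *)
Definition rnorm (V : normedModType R[i]) (x : V) : R := complex.Re `|x|.

Definition opnorm (f : X -> X) : \bar R :=
  ereal_sup [set (rnorm (f x))%:E | x in [set x : X | rnorm x <= 1]].

Definition bounded_operator (f : X -> X) : Prop :=
  linear f /\ (opnorm f < +oo)%E.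

Definition GL : set (X -> X) :=
  [set f | bounded_operator f /\
     exists2 h, bounded_operator h & cancel f h /\ cancel h f].

Definition separable_space : Prop :=
  exists2 A : set X, countable A & dense A.

Definition infinite_dimensional : Prop :=
  forall (n : nat) (v : 'I_n -> X),
    exists x : X, forall c : 'I_n -> R[i], x <> \sum_(i < n) c i *: v i.

End Operators.

Section Jamison.
Variables (R : realType) (G : zmodType).

Record representation := Representation {
  rep_space : completeNormedModType R[i];
  rep_op :> G -> rep_space -> rep_space;
  rep_separable : separable_space rep_space;
  rep_infinite_dimensional : infinite_dimensional rep_space;
  rep_GL : forall x, GL (rep_op x);
  rep_morph : {morph rep_op : x y / x + y >-> x \o y}
}.

Definition unimodular_eigenvalues (rho : representation) : set (G -> R[i]) :=
  [set chi | dual_group R G chi /\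
     exists2 e : rep_space rho, e <> 0 & forall x, rho x e = chi x *: e].

Definition partially_bounded (rho : representation) (g : nat -> G) : Prop :=
  (ereal_sup (range (fun k => opnorm (rho (g k)))) < +oo)%E.

Definition Jamison_sequence (g : nat -> G) : Prop :=
  forall rho : representation, partially_bounded rho g ->
    countable (unimodular_eigenvalues rho).

End Jamison.

(* Main.v *)
Require Import Defs.
From mathcomp Require Import all_boot all_order all_algebra ring_quotient.
From mathcomp Require Import all_classical all_reals all_analysis.

(** The subgroup generated by the [g k] is written G0 below.

    The eigenvectors of two characters with different restrictions to G0 cannot
    be close.  Indeed, if [chi] and [psi] are eigenvalues with unit
    eigenvectors [u] and [v], then
      (chi (g k) - psi (g k)) u = (rho (g k) - psi (g k)) (u - v),
    so |chi (g k) - psi (g k)| <= (M + 1) |u - v|, where M bounds the norms of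
    the operators [rho (g k)] ([eigenvalue_dist]).  If |u - v| is at most
    eps / (2 (M + 1)), the character [chi / psi] of G0 stays within eps / 2 of
    1 at every [g k], hence is trivial by hypothesis ([characters_agree]).

    Since the space is separable, assigning to each eigenvalue a point of a
    countable dense set near a unit eigenvector of it partitions the eigenvalues
    into countably many families, and any two members of a family agree on G0.
    Characters of G that agree on G0 differ by a character of G / G0
    ([dual_group_coset]), so each family is countable because the dual of
    G / G0 is ([countable_agreeing_characters]). *)

Set Implicit Arguments.
Unset Strict Implicit.

Import Order.TTheory GRing.Theory Num.Theory.
Local Open Scope classical_set_scope.
Local Open Scope ring_scope.

(** The norms of the complex spaces take values in [R[i]], where they are real:
    this is what lets real bounds be compared with them. *)
Lemma rnormK (R : realType) (V : normedModType R[i]) (v : V) :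
  (rnorm v)%:C%C = `|v|.
Proof. by rewrite /rnorm RRe_real// normr_real. Qed.

Lemma normr_opnorm (R : realType) (X : completeNormedModType R[i])
  (f : X -> X) (M : R) (v : X) :
  linear f -> (opnorm f <= M%:E)%E -> `|f v| <= M%:C%C * `|v|.
Proof.
move=> lin_f le_fM.
have fZ c u : f (c *: u) = c *: f u := GRing.scalable_linear lin_f c u.
have [->|v_neq0] := eqVneq v 0.
  by rewrite -(scale0r (0 : X)) fZ !scale0r !normr0 mulr0.
have v_gt0 : 0 < `|v| by rewrite normr_gt0.
set w := `|v|^-1 *: v.
have norm_w : `|w| = 1.
  by rewrite normrZ normfV normr_id mulVf// gt_eqF.
(* [opnorm] only looks at the unit ball, which contains [w]. *)
have : rnorm (f w) <= M.
  rewrite -lee_fin; apply: le_trans le_fM.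
  by apply: ereal_sup_ubound; exists w => //=; rewrite /rnorm norm_w.
by rewrite -lecR rnormK fZ normrZ normfV normr_id ler_pdivrMl// mulrC.
Qed.

Lemma partially_bounded_ubound (R : realType) (G : zmodType)
  (rho : representation R G) (g : nat -> G) :
  partially_bounded rho g ->
  exists2 M : R, 0 <= M & forall k, (opnorm (rho (g k)) <= M%:E)%E.
Proof.
rewrite /partially_bounded; set s := ereal_sup _ => s_fin.
exists (Num.max 0 (fine s)); first by rewrite le_max lexx.
move=> k; have : (opnorm (rho (g k)) <= s)%E.
  by apply: ereal_sup_ubound; exists k.
move=> /le_trans; apply; case: s s_fin => [r|//|] _ /=.
  by rewrite lee_fin le_max lexx orbT.
by rewrite leNye.
Qed.

(** As [u] is a unit vector, |a - b| is the norm of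
    (a - b) u = (f - b)(u - v), which the operator bound controls. *)
Lemma eigenvalue_dist (R : realType) (X : completeNormedModType R[i])
  (f : X -> X) (M : R) (a b : R[i]) (u v : X) :
  linear f -> (opnorm f <= M%:E)%E -> `|u| = 1 -> `|b| = 1 ->
  f u = a *: u -> f v = b *: v ->
  `|a - b| <= (M + 1)%:C%C * `|u - v|.
Proof.
move=> lin_f le_fM norm_u norm_b fu fv.
have abE : (a - b) *: u = f (u - v) - b *: (u - v).
  rewrite (GRing.zmod_morphism_linear lin_f) fu fv scalerBl scalerBr.
  by rewrite opprB addrA addrNK.
rewrite -[leLHS]mulr1 -norm_u -normrZ abE.
apply: le_trans (ler_normB _ _) _.
rewrite normrZ norm_b rmorphD mulrDl rmorph1 lerD2r.
exact: normr_opnorm.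
Qed.

Lemma dual_group_div (R : realType) (G : zmodType) (chi psi : G -> R[i]) :
  dual_group R G chi -> dual_group R G psi ->
  dual_group R G (fun x => chi x / psi x).
Proof.
move=> [chi1 chiD] [psi1 psiD]; split=> [x|x y].
  by rewrite normf_div chi1 psi1 divr1.
by rewrite chiD psiD invfM mulrACA.
Qed.

Lemma dual_group_neq0 (R : realType) (G : zmodType) (chi : G -> R[i]) x :
  dual_group R G chi -> chi x != 0.
Proof. by case=> chi1 _; rewrite -normr_gt0 chi1. Qed.

(** The quotient of the two characters restricts to a character of the generated
    subgroup that is too close to 1 at every generator to be nontrivial.  Half
    of [eps] leaves room for a supremum that is not attained. *)
Lemma characters_agree (R : realType) (G : zmodType) (g : nat -> G)
  (eps : R) (chi psi : G -> R[i]) :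
  0 < eps ->
  (forall chi : gen_subgroup g -> R[i],
     dual_group R (gen_subgroup g) chi -> chi <> cst 1 ->
     eps <= sup (range (fun k => complex.Re `|chi (gen_elt g k) - 1|))) ->
  dual_group R G chi -> dual_group R G psi ->
  (forall k, `|chi (g k) - psi (g k)| <= (eps / 2)%:C%C) ->
  {in gen_pred g, chi =1 psi}.
Proof.
move=> eps_gt0 sep dchi dpsi close x gx.
have [res_chi resD] := dual_group_div dchi dpsi.
pose eta (y : gen_subgroup g) := chi (gen_val y) / psi (gen_val y).
have deta : dual_group R (gen_subgroup g) eta.
  by split=> [y|y z]; [exact: res_chi|exact: resD].
have eta1 : eta = cst 1.
  apply: contrapT => /(sep _ deta); apply/negP; rewrite -ltNge.
  apply: (@le_lt_trans _ _ (eps / 2)); last first.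
    by rewrite ltr_pdivrMr// ltr_pMr// ltr1n.
  apply: ge_sup; first by exists (complex.Re `|eta (gen_elt g 0) - 1|), 0%N.
  move=> _ [k _ <-]; rewrite -lecR RRe_real ?normr_real// /eta/=.
  rewrite -(divff (dual_group_neq0 (g k) dpsi)) -mulrBl normf_div.
  by case: dpsi => -> _; rewrite divr1.
have := congr1 (fun h => h (GenSubgroup gx)) eta1.
rewrite /eta/= => /divr1_eq; exact.
Qed.

(** [chi / psi] is trivial on the generated subgroup, so it factors through
    the quotient; its factorization is evaluated on representatives. *)
Lemma dual_group_coset (R : realType) (G : zmodType) (g : nat -> G)
  (chi psi : G -> R[i]) :
  dual_group R G chi -> dual_group R G psi -> {in gen_pred g, chi =1 psi} ->
  exists2 eta, dual_group R (gen_quotient g) eta &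
    chi = (fun x => psi x * eta (\pi_(gen_quotient g) x)%qT).
Proof.
move=> dchi dpsi chi_psi.
have dq := dual_group_div dchi dpsi; set q := fun x => _ / _ in dq.
have [q1 qD] := dq.
have qpi x y : x - y \in gen_pred g -> q x = q y.
  move=> xy; rewrite -[x](subrK y) qD {1}/q chi_psi// divff ?mul1r//.
  exact: dual_group_neq0 dpsi.
have q_repr x : q (repr (\pi_(gen_quotient g) x)%qT) = q x.
  by apply: qpi; rewrite Quotient.idealrBE reprK.
exists (fun z : gen_quotient g => q (repr z)); first split=> [z|y z].
- exact: q1.
- rewrite -qD -[RHS]q_repr; congr (q (repr _)).
  by rewrite [RHS]Quotient.pi_add/= !reprK.
apply/funext => x; rewrite q_repr /q mulrCA divff ?mulr1//.
exact: dual_group_neq0 dpsi.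
Qed.

(** A nonempty family of this kind lies in a single coset of the dual of the
    quotient, the latter being viewed as a group of characters of [G]. *)
Lemma countable_agreeing_characters (R : realType) (G : zmodType)
  (g : nat -> G) (F : set (G -> R[i])) :
  countable (dual_group R (gen_quotient g)) ->
  F `<=` dual_group R G ->
  (forall chi psi, F chi -> F psi -> {in gen_pred g, chi =1 psi}) ->
  countable F.
Proof.
move=> cG dF agree.
have [[psi Fpsi]|F0] := pselect (F !=set0); last first.
  by move/set0P/negP/negPn/eqP: F0 => ->; exact: countable0.
apply: (@sub_countable _ _ _ ((fun (eta : gen_quotient g -> R[i]) x =>
    psi x * eta (\pi_(gen_quotient g) x)%qT) @` dual_group R (gen_quotient g))).
  apply: subset_card_le => chi Fchi.
  have [eta deta ->] := dual_group_coset (dF _ Fchi) (dF _ Fpsi)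
    (agree _ _ Fchi Fpsi).
  by exists eta.
exact: sub_countable (card_image_le _ _) cG.
Qed.

Theorem proposition2p2 (R : realType) (G : zmodType) (g : nat -> G)
  (G_countably_infinite : ([set: G] #= [set: nat])%card)
  (dual_quotient_countable : countable (dual_group R (gen_quotient g)))
  (separated : exists2 eps : R, 0 < eps &
     forall chi : gen_subgroup g -> R[i],
       dual_group R (gen_subgroup g) chi -> chi <> cst 1 ->
       eps <= sup (range (fun k : nat => complex.Re `|chi (gen_elt g k) - 1|))) :
  Jamison_sequence R g.
Proof.
move=> rho /partially_bounded_ubound [M M_ge0 le_M].
have [eps eps_gt0 sep] := separated.
have [A countA denseA] := rep_separable rho.
have M1_gt0 : 0 < (M + 1)%:C%C :> R[i] by rewrite ltcR ltr_wpDl.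
(* [d] is half the separation constant: two unit eigenvectors within [d] of
   the same dense point are within eps / (2 (M + 1)) of each other. *)
pose d : R[i] := (eps / 2)%:C%C / (M + 1)%:C%C / 2.
have d_gt0 : 0 < d by rewrite !divr_gt0// ltcR divr_gt0.
pose F (a : rep_space rho) := [set chi | dual_group R G chi /\
  exists2 e : rep_space rho, `|e| = 1 /\ `|e - a| < d &
    forall x, rho x e = chi x *: e].
apply: (@sub_countable _ _ _ (\bigcup_(a in A) F a)).
  apply: subset_card_le => chi [dchi [e /eqP e_neq0 rho_e]].
  have e_gt0 : 0 < `|e| by rewrite normr_gt0.
  pose u := `|e|^-1 *: e.
  have [] := denseA (ball u d).
  - by exists u; exact: ballxx.
  - exact: ball_open.
  move=> a [ua Aa]; exists a => //; split=> //.
  exists u; first split.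
  - by rewrite normrZ normfV normr_id mulVf// gt_eqF.
  - by rewrite -ball_normE in ua.
  move=> x; have [[lin_x _] _] := rep_GL rho x.
  by rewrite [LHS](GRing.scalable_linear lin_x) /= rho_e !scalerA mulrC.
apply: bigcup_countable => // a _.
apply: countable_agreeing_characters dual_quotient_countable _ _ => [chi []//|].
move=> chi psi [dchi [u [u1 ua] rho_u]] [dpsi [v [v1 va] rho_v]].
apply: (characters_agree eps_gt0 sep dchi dpsi) => k.
have [[lin_k _] _] := rep_GL rho (g k).
apply: le_trans (eigenvalue_dist lin_k (le_M k) u1 (proj1 dpsi _)
  (rho_u _) (rho_v _)) _.
rewrite -ler_pdivlMl// mulrC.
rewrite [leRHS]splitr -/d; apply: le_trans (ler_distD a _ _) _.
by rewrite lerD// ltW// distrC.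
Qed.
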